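(* For every integer $k\ge 0$ and every real $r\ge 0$, there exist $L,C\ge 1$ such that the following holds. If a graph $G$ admits a path-decomposition $(T,(B_t:t\in V(T)))$ such that for each $t\in V(T)$, $B_t$ is the union of at most $k$ sets each with diameter at most $r$ in $G$, then $G$ admits an $(L,C)$-quasi-isometry to a graph with path-width at most $k$.
   Context: Graphs may be infinite, and need not be connected. $\dist_G(u,v)$ is the number of edges in a shortest path of $G$ between $u,v$ ($\infty$ if there is none). The diameter of $X\subseteq V(G)$ in $G$ is the maximum of $\dist_G(u,v)$ over all $u,v\in X$ (distances are measured in $G$, not in $G[X]$). For $L,C\ge 0$, a map $\phi:V(G)\to V(H)$ is an $(L,C)$-quasi-isometry from $G$ to $H$ if: (i) for all $u,v\in V(G)$, if $\dist_G(u,v)$ is finite then $\dist_H(\phi(u),\phi(v))\le L\dist_G(u,v)+C$; (ii) for all $u,v\in V(G)$, if $\dist_H(\phi(u),\phi(v))$ is finite then $\dist_G(u,v)\le L\dist_H(\phi(u),\phi(v))+C$; (iii) for every $y\in V(H)$ there exists $v\in V(G)$ with $\dist_H(\phi(v),y)\le C$. ''$G$ admits an $(L,C)$-quasi-isometry to $H$'' means such a $\phi$ exists. A tree-decomposition of $G$ is a pair $(T,(B_t:t\in V(T)))$ where $T$ is a (possibly infinite) tree and each $B_t\subseteq V(G)$, such that $G$ is the union of the graphs $G[B_t]$ $(t\in V(T))$ and $B_{t_1}\cap B_{t_3}\subseteq B_{t_2}$ whenever $t_2$ lies on the path of $T$ between $t_1,t_3$. It is a path-decomposition if $T$ is a (finite,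 one-way infinite or two-way infinite) path. Its width is the maximum of $|B_t|-1$ over $t\in V(T)$ (or $\infty$ if there is no finite maximum); the path-width of $G$ is the minimum width of a path-decomposition of $G$. *)

(* Defs.v *)
(* MathComp-Analysis; real parameters live in an arbitrary R : realType. *)
From mathcomp Require Import all_boot all_order all_algebra.
From mathcomp Require Import all_classical all_reals ereal.
Set Implicit Arguments.
Unset Strict Implicit.
Unset Printing Implicit Defensive.
Import Order.TTheory GRing.Theory Num.Theory.
Local Open Scope classical_set_scope.
Local Open Scope ring_scope.

Record graph := Graph {
  vertex :> Type;
  adj : vertex -> vertex -> Prop;
  adj_sym : forall u v, adj u v -> adj v u;
  adj_irrefl : forall u, ~ adj u u }.

(* [p 0, ..., p n] is a path with n edges; the values of [p] beyond n are
   irrelevant. *)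
Definition path_of_length (G : graph) (p : nat -> G) (n : nat) : Prop :=
  (forall i j, (i <= n)%N -> (j <= n)%N -> p i = p j -> i = j) /\
  (forall i, (i < n)%N -> adj (p i) (p i.+1)).

Definition path_between (G : graph) (u v : G) (p : nat -> G) (n : nat) : Prop :=
  [/\ path_of_length p n, p 0%N = u & p n = v].

(* The infimum is a minimum if some path joins u and v, and +oo otherwise. *)
Definition dist (R : realType) (G : graph) (u v : G) : \bar R :=
  ereal_inf [set n%:R%:E | n in [set n | exists p, path_between u v p n]].

(* Equal to -oo if [X] is empty, so that the empty set has diameter at most
   any given real. *)
Definition diameter (R : realType) (G : graph) (X : set G) : \bar R :=
  ereal_sup [set d | exists u v, [/\ X u, X v & d = dist R u v]].

Definition quasi_isometry (R : realType) (L C : R) (G H : graph)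
    (phi : G -> H) : Prop :=
  [/\ forall u v, (dist R u v < +oo)%E ->
        (dist R (phi u) (phi v) <= L%:E * dist R u v + C%:E)%E,
      forall u v, (dist R (phi u) (phi v) < +oo)%E ->
        (dist R u v <= L%:E * dist R (phi u) (phi v) + C%:E)%E
    & forall y : H, exists v : G, (dist R (phi v) y <= C%:E)%E].

Definition admits_quasi_isometry (R : realType) (L C : R) (G H : graph) : Prop :=
  exists phi : G -> H, quasi_isometry L C phi.

Definition connected_graph (G : graph) : Prop :=
  forall u v : G, exists p n, path_between u v p n.

Definition acyclic_graph (G : graph) : Prop :=
  forall (p : nat -> G) n,
    (2 <= n)%N -> path_of_length p n -> ~ adj (p n) (p 0%N).

Definition is_tree (T : graph) : Prop :=
  [/\ inhabited T, connected_graph T & acyclic_graph T].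

Definition on_path_between (T : graph) (t1 t2 t3 : T) : Prop :=
  exists p n, path_between t1 t3 p n /\ exists2 i, (i <= n)%N & p i = t2.

(* The first two clauses of the conjunction following [is_tree] say that G is
   the union of the induced subgraphs G[B t]. *)
Definition tree_decomposition (G T : graph) (B : T -> set G) : Prop :=
  is_tree T /\
  [/\ forall v : G, exists t, B t v,
      forall u v : G, adj u v -> exists t, B t u /\ B t v
    & forall t1 t2 t3 : T, on_path_between t1 t2 t3 ->
        B t1 `&` B t3 `<=` B t2].

(* T is isomorphic to the graph on D joining consecutive integers, where D is
   {0, ..., n} (finite path), the nonnegative integers (one-way infinite path)
   or all integers (two-way infinite path). *)
Definition is_path_graph (T : graph) : Prop :=
  exists (D : set int) (f : T -> int),
    [/\ [\/ exists n : nat, D = [set i | 0 <= i <= n%:Z],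
            D = [set i | 0 <= i] | D = setT],
        injective f, range f = D
      & forall s t : T, adj s t <-> (f t = f s + 1 \/ f s = f t + 1)].

Definition path_decomposition (G T : graph) (B : T -> set G) : Prop :=
  is_path_graph T /\ tree_decomposition B.

(* Number of elements of a set; +oo (infimum of the empty set) if infinite. *)
Definition ecard (R : realType) (V : Type) (A : set V) : \bar R :=
  ereal_inf [set n%:R%:E | n in [set n | (A #= `I_n)%card]].

Definition width (R : realType) (G T : graph) (B : T -> set G) : \bar R :=
  ereal_sup [set (ecard R (B t) - 1)%E | t in setT].

(* All widths are integers or +oo, and at least -1, so the infimum is a
   minimum. *)
Definition pathwidth (R : realType) (G : graph) : \bar R :=
  ereal_inf [set w | exists (T : graph) (B : T -> set G),
    path_decomposition B /\ w = width R B].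

(* Main.v *)
(** Index the bags by the integers and call two vertices close when their distance is
    at most [r] (rounded up), so that every bag is a union of [k] cliques of the
    closeness relation.  Sweep away from time 0, in both directions, keeping an
    anchor vertex of the current bag.  When it dies, replace it by the vertex close to
    it that lives longest.  A vertex close to an anchor is absorbed for the rest of its life.
    It cannot outlive the next anchor, so while it lives the anchor changes at most once.
    The clique of the current anchor is absorbed entirely, so the unabsorbed
    parts of the bags are unions of [k - 1] cliques, and [k] repetitions exhaust [G].

    The vertices of [H] are the pairs (repetition, maximal period without a change of
    anchor).  The vertices of [G] absorbed in one such pair have bounded mutual distance.
    During its life a vertex of [G] only moves to earlier and earlier repetitions, with
    at most one change of anchor in each, hence visits boundedly many vertices of [H].
    At each time [k] vertices of [H] are current, and changing them one at a time costs
    one extra place in the bags. *)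

Require Import Defs.
From mathcomp Require Import all_boot all_order all_algebra.
From mathcomp Require Import all_classical all_reals ereal.
From mathcomp Require Import zify.
Set Implicit Arguments.
Unset Strict Implicit.
Unset Printing Implicit Defensive.
Import Order.TTheory GRing.Theory Num.Theory.
Local Open Scope classical_set_scope.

(** * Anchors on one side *)

Section Sweep.
Variables (V : Type) (E : V -> V -> Prop).
Hypothesis Erefl : forall u, E u u.
Hypothesis Esym : forall u v, E u v -> E v u.

(* Holds when [X] is a union of at most [j] cliques of [E]; unlike that
   property it is visibly inherited, with [j] decreased, when the closed
   neighbourhood of a point of [X] is deleted. *)
Fixpoint covers (j : nat) (X : set V) : Prop :=
  if j is j'.+1 then forall q, X q -> covers j' (X `\` E q) else X = set0.

Lemma covers_sub j (X Y : set V) : X `<=` Y -> covers j Y -> covers j X.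
Proof.
elim: j X Y => [|j IH] X Y XY /= cY; first by rewrite -subset0 -cY.
by move=> q Xq; apply: IH (cY q (XY q Xq)) => u [/XY Yu nE]; split.
Qed.

(** The clique [F i] containing [q] lies inside [E q], so deleting [E q] leaves only points of the
    other cliques. *)
Lemma covers_bigcup j (F : 'I_j -> set V) (X : set V) :
  (forall i u v, F i u -> F i v -> E u v) -> X `<=` \bigcup_i F i -> covers j X.
Proof.
elim: j F X => [|j IH] F X clq XF /=.
  by rewrite -subset0 => u /XF [[]].
move=> q Xq; have [i _ Fiq] := XF q Xq.
apply: (IH (fun m => F (lift i m))) => [m|u [Xu nqu]]; first exact: clq.
have [m _ Fmu] := XF u Xu; case: (unliftP i m) Fmu => [m' ->|->] Fmu.
  by exists m'.
by case: nqu; apply: clq Fmu.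
Qed.

Lemma covers_le i j X : (i <= j)%N -> covers i X -> covers j X.
Proof.
have coversS m Y : covers m Y -> covers m.+1 Y.
  elim: m Y => [|m IH] Y cY q Yq; first by rewrite cY in Yq.
  by apply: IH; apply: cY.
by move=> /subnK <- cX; elim: (j - i)%N => //= m; exact: coversS.
Qed.

(** A chosen point in the form of a set, so that anchors make sense over empty bags too. *)
Definition pick1 (X : set V) : set V :=
  [set a | exists e : exists b, X b, a = projT1 (cid e)].

Lemma pick1_sub X : pick1 X `<=` X.
Proof. by move=> _ [e ->]; exact: projT2 (cid e). Qed.

Lemma pick1_neq0 X : X !=set0 -> pick1 X !=set0.
Proof. by move=> e; exists (projT1 (cid e)); exists e. Qed.

Lemma pick1_inj X a b : pick1 X a -> pick1 X b -> a = b.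
Proof. by move=> [e ->] [e' ->]; rewrite (Prop_irrelevance e e'). Qed.

Definition interval_bags (B : nat -> set V) : Prop :=
  forall u s x s', (s <= x <= s')%N -> B s u -> B s' u -> B x u.

(** From time [t] on, [A] lives as long as any point of [Q]. It is a set because the points of [Q]
    may have finite but unbounded lifetimes: then no single point outlasts [Q], but [Q] itself never
    dies. *)
Definition outlasting (B : nat -> set V) (t : nat) (Q A : set V) : Prop :=
  [/\ A `<=` Q,
    forall s, (t <= s)%N -> Q `&` B s !=set0 -> A `&` B s !=set0
    & (forall a b, A a -> A b -> a = b) \/
      forall s, (t <= s)%N -> A `&` B s !=set0].

Lemma outlasting_ex (B : nat -> set V) (t : nat) (Q : set V) :
  Q `<=` B t ->
  interval_bags B -> exists A, outlasting B t Q A.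
Proof.
move=> QB conv; have [fQ|nfQ] := pselect (forall s, (t <= s)%N -> Q `&` B s !=set0).
  by exists Q; split=> //; right.
have [s0 ts0 Qs0] : exists2 s, (t <= s)%N & ~ (Q `&` B s !=set0).
  by apply: contrapT => h; apply: nfQ => s ts; apply: contrapT => ?; apply: h; exists s.
have [[q Qq]|Q0] := pselect (Q !=set0); last first.
  by exists set0; split => // [s _ [u [Qu _]]|]; [case: Q0; exists u | left].
(* [Q] is dead at [s0], so there is a last time at which it is alive, and a point alive then
   outlasts it. *)
pose P s := `[< (t <= s)%N /\ Q `&` B s !=set0 >].
have Ps s : P s -> (s <= s0)%N.
  move=> /asboolP [ts [u [Qu Bu]]]; rewrite leqNgt; apply/negP => s0s.
  by apply: Qs0; exists u; split=> //; apply: (conv _ t s0 s) => //; [rewrite ts0 ltnW | exact: QB].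
have exP : exists s, P s.
  by exists t; apply/asboolP; split=> //; exists q; split=> //; apply: QB.
case: (ex_maxnP exP Ps) => m /asboolP [tm [u [Qu Bmu]]] mmax.
exists [set u]; split=> [_ -> //|s ts Qs|]; last by left => a b -> ->.
exists u; split=> //; apply: (conv _ t s m) => //; last exact: QB.
by rewrite ts mmax //; apply/asboolP.
Qed.

Variable B : nat -> set V.
Definition heirs (t : nat) (A : set V) : set V :=
  [set u | [/\ B t u, B t.+1 u & exists2 a, (A `&` B t) a & E a u]].

Lemma heirs_sub t A : heirs t A `<=` B t.+1. Proof. by move=> u []. Qed.

(** The definition tests for an outlasting set because the bags are not yet assumed to be intervals;
    [anchorP] shows that the test fails only if there are no heirs. *)
Definition succession (t : nat) (A : set V) : set V :=
  if pselect (heirs t A !=set0 /\ exists C, outlasting B t.+1 (heirs t A) C) is left h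
  then projT1 (cid (proj2 h)) else pick1 (B t.+1).

(* An anchor is kept as long as one of its points is alive.  It is replaced by the
   neighbour of a dying point that lives longest, or, if the neighbours live
   arbitrarily long, by the set of all of them, which then never dies. *)
Fixpoint anchor (t : nat) : set V :=
  if t is t'.+1 then
    if pselect (anchor t' `&` B t !=set0) then anchor t' else succession t' (anchor t')
  else pick1 (B 0%N).

(** The first time of the current period, used as the name of that period. *)
Fixpoint stint (t : nat) : nat :=
  if t is t'.+1 then
    if pselect (anchor t' `&` B t !=set0) then stint t' else t
  else 0%N.

Hypothesis conv : interval_bags B.

Variant anchor_step (t : nat) : set V -> nat -> Prop :=
| AnchorKept of anchor t `&` B t.+1 !=set0 : anchor_step t (anchor t) (stint t)
| AnchorHeir A of ~ (anchor t `&` B t.+1 !=set0) & heirs t (anchor t) !=set0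
    & outlasting B t.+1 (heirs t (anchor t)) A : anchor_step t A t.+1
| AnchorNew of ~ (anchor t `&` B t.+1 !=set0) & ~ (heirs t (anchor t) !=set0) :
    anchor_step t (pick1 (B t.+1)) t.+1.

Lemma anchorP t : anchor_step t (anchor t.+1) (stint t.+1).
Proof.
rewrite /=; case: pselect => h; first exact: AnchorKept.
rewrite /succession; case: pselect => [h'|nh].
  by apply: AnchorHeir; [| exact: (proj1 h') | exact: projT2 (cid _)].
apply: AnchorNew => // h'; apply: nh; split=> //.
exact: (outlasting_ex (@heirs_sub t _) conv).
Qed.

Lemma anchor_alive t : B t !=set0 -> anchor t `&` B t !=set0.
Proof.
case: t => [|t] B0.
  by have [a aP] := pick1_neq0 B0; exists a; split=> //; apply: pick1_sub.
case: anchorP => // [A _ [u uh] [_ outl _]|_ _].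
  by apply: (outl t.+1) => //; exists u; split=> //; case: uh.
by have [a aP] := pick1_neq0 B0; exists a; split=> //; apply: pick1_sub.
Qed.

Lemma anchor_single_or_immortal t :
  (forall a b, anchor t a -> anchor t b -> a = b) \/
  forall s, (t <= s)%N -> anchor t `&` B s !=set0.
Proof.
elim: t => [|t IH]; first by left => a b; exact: pick1_inj.
case: anchorP => [h|A _ _ [_ _ []]|]; [|by left|by right|by move=> _ _; left => a b; exact: pick1_inj].
by case: IH => [|im]; [left | right=> s /ltnW; exact: im].
Qed.

(** An anchor with several points never dies, so the heirs of a dying anchor are all close to one
    and the same point. *)
Lemma dying_anchor_single t a b :
  ~ (anchor t `&` B t.+1 !=set0) -> anchor t a -> anchor t b -> a = b.
Proof.
case: (anchor_single_or_immortal t) => [h _|im dead]; first exact: h.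
by case: dead; apply: im.
Qed.

(** An anchor with several points consists of heirs of one dead point, which is their common
    neighbour. *)
Lemma anchor_near t a b : anchor t a -> anchor t b -> exists2 c, E c a & E c b.
Proof.
elim: t a b => [|t IH] a b.
  by move=> Aa Ab; rewrite (pick1_inj Ab Aa); exists a.
case: anchorP => [_|A dead _ [sub _ _] /sub [_ _ [c [Ac _] ca]] /sub [_ _ [d [Ad _] db]]|]; first exact: IH.
  by rewrite (dying_anchor_single dead Ad Ac) in db; exists c.
by move=> _ _ Aa Ab; rewrite (pick1_inj Ab Aa); exists a.
Qed.

Lemma stint_kept t : anchor t `&` B t.+1 !=set0 -> stint t.+1 = stint t.
Proof. by case: anchorP. Qed.

Lemma stint_new t : ~ (anchor t `&` B t.+1 !=set0) -> stint t.+1 = t.+1.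
Proof. by case: anchorP. Qed.

Lemma stint_le t : (stint t <= t)%N.
Proof. by elim: t => // t IH; case: anchorP => // _; apply: leqW. Qed.

Lemma stint_mono s t : (s <= t)%N -> (stint s <= stint t)%N.
Proof.
move=> /subnK <-; elim: (t - s)%N => // m IH; rewrite addSn.
by case: anchorP => //; rewrite -addSn => *; apply: leq_trans (stint_le s) _; rewrite leq_addl.
Qed.

Lemma stint_anchor s t : stint s = stint t -> anchor s = anchor t.
Proof.
wlog st : s t / (s <= t)%N.
  by move=> h; case: (leqP s t) => [|/ltnW] le e; [exact: h|symmetry; exact: h].
move: st => /subnK <-; elim: (t - s)%N => // m IH; rewrite addSn.
have le := stint_le s.
case: anchorP => // [A|] *; lia.
Qed.

Definition absorbed (t : nat) : set V :=
  [set u | B t u /\ exists s a, [/\ (s <= t)%N, anchor s a, B s a, B s u & E a u]].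

Lemma absorbed_sub t : absorbed t `<=` B t. Proof. by move=> u []. Qed.

Lemma absorbed_le s t u : (s <= t)%N -> absorbed s u -> B t u -> absorbed t u.
Proof.
move=> st [_ [x [a [xs Aa Ba Bu Eau]]]] Btu; split=> //.
by exists x, a; split=> //; apply: leq_trans st.
Qed.

(** Some point of the current anchor is alive, and its whole neighbourhood in the bag is
    absorbed. *)
Lemma covers_absorbed j t : covers j.+1 (B t) -> covers j (B t `\` absorbed t).
Proof.
move=> cB; have [B0|B0] := pselect (B t !=set0); last first.
  have e : B t `\` absorbed t = set0.
    by rewrite -subset0 => u [Bu _]; apply: B0; exists u.
  by rewrite e; apply: (@covers_le 0).
have [a [Aa Ba]] := anchor_alive B0.
apply: covers_sub (cB a Ba) => u [Bu nu]; split=> // Eau; apply: nu.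
by split=> //; exists t, a.
Qed.

(* A point survives at most one change of anchor after being absorbed, since
   the second anchor outlasts it. *)
Lemma stint_change s t a u : anchor s a -> B s a -> B s u -> E a u ->
  (s <= t)%N -> B t u ->
  stint t = stint s \/ exists x, [/\ (s <= x < t)%N, stint x = stint s,
    stint x.+1 = stint t, stint t = x.+1 & heirs x (anchor x) u].
Proof.
move=> Aa Ba Bu Eau /subnK <-; elim: (t - s)%N => [|m IH]; first by left.
rewrite addSn => Bmu; have Bu' : B (m + s)%N u.
  by apply: (@conv u s (m + s)%N (m + s).+1) => //; rewrite leq_addl /=.
have Bmn0 : B (m + s)%N !=set0 by exists u.
have [e|[x [/andP[sx xm] e1 e2 e3 xu]]] := IH Bu'.
  (* No change so far: if the anchor dies now, [u] is close to its only point and is an heir. *)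
  have [al|dead] := pselect (anchor (m + s)%N `&` B (m + s).+1 !=set0).
    by left; rewrite stint_kept.
  right; exists (m + s)%N; rewrite stint_new //; split=> //; first by rewrite leq_addl /=.
  have [b [Ab Bb]] := anchor_alive Bmn0.
  split=> //; exists b => //.
  by rewrite -(stint_anchor e) in Aa; rewrite (dying_anchor_single dead Ab Aa).
(* At the change after [x], [u] was an heir, so the present anchor lives as long as [u]. *)
right; exists x; have al : anchor (m + s)%N `&` B (m + s).+1 !=set0.
  rewrite -(stint_anchor e2); move: e3; rewrite -e2; case: anchorP => [al e3|A dead _ [_ outl _] _|_ []].
  - by have := stint_le x; rewrite e3 ltnn.
  - by apply: outl; [lia | exists u].
  - by exists u.
by rewrite (stint_kept al); split=> //; rewrite sx /= ltnW.
Qed.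

(** Before any change, [u] is close to a point of the anchor. After the one possible change, [u] and
    the new anchor are heirs of the same dead point [c]. *)
Lemma absorbed_near_anchor t u :
  absorbed t u -> exists a, anchor t a /\ exists2 c, E u c & E c a.
Proof.
move=> [Btu [s [a [st Aa Ba Bu Eau]]]].
have [e|[x [_ _ e2 e3 uh]]] := stint_change Aa Ba Bu Eau st Btu.
  by exists a; split; [rewrite (stint_anchor e) | exists u => //; exact: Esym].
have [b [Ab _]] : anchor t `&` B t !=set0 by apply: anchor_alive; exists u.
exists b; split=> //; have [_ _ [c [Ac _] Ecu]] := uh; move: Ab e3; rewrite -(stint_anchor e2) -e2.
case: anchorP => [al _ e3|A dead _ [sub _ _] /sub [_ _ [d [Ad _] Edb]] _|_ h].
- by have := stint_le x; rewrite e3 ltnn.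
- by rewrite (dying_anchor_single dead Ad Ac) in Edb; exists c => //; exact: Esym.
- by case: h; exists u.
Qed.

End Sweep.

(** * Walks with a bounded number of steps *)

Fixpoint reach (T : Type) (e : T -> T -> Prop) (n : nat) (x y : T) : Prop :=
  if n is n'.+1 then exists2 z, x = z \/ e x z & reach e n' z y else x = y.

Lemma reach_refl T (e : T -> T -> Prop) n x : reach e n x x.
Proof. by elim: n => // n IH; exists x => //; left. Qed.

Lemma reach1 T (e : T -> T -> Prop) x y : x = y \/ e x y -> reach e 1 x y.
Proof. by exists y. Qed.

Lemma reach_trans T (e : T -> T -> Prop) m n x y z :
  reach e m x y -> reach e n y z -> reach e (m + n)%N x z.
Proof.
elim: m x => [|m IH] x; first by move=> ->.
by move=> [w xw wy] yz; exists w => //; exact: IH.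
Qed.

Lemma reach_le T (e : T -> T -> Prop) m n x y :
  (m <= n)%N -> reach e m x y -> reach e n x y.
Proof.
by move=> /subnKC <- xy; apply: reach_trans xy (reach_refl _ _ _).
Qed.

Lemma reach_sym T (e : T -> T -> Prop) n x y :
  (forall u v, e u v -> e v u) -> reach e n x y -> reach e n y x.
Proof.
move=> es; elim: n x y => [|n IH] x y; first by move=> ->.
move=> [z xz zy]; rewrite -addn1; apply: reach_trans (IH _ _ zy) _; apply: reach1.
by case: xz => [->|/es]; [left | right].
Qed.

Lemma reach_map T T' (e : T -> T -> Prop) (e' : T' -> T' -> Prop) (f : T -> T') n x y :
  (forall u v, e u v -> f u = f v \/ e' (f u) (f v)) ->
  reach e n x y -> reach e' n (f x) (f y).
Proof.
move=> h; elim: n x => [|n IH] x /=; first by move->.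
by move=> [z xz zy]; exists (f z); [case: xz => [->|/h]; [left|] | exact: IH].
Qed.

(** * Iterating the absorption *)

Section Levels.
Variables (V : Type) (E : V -> V -> Prop).
Hypothesis Erefl : forall u, E u u.
Hypothesis Esym : forall u v, E u v -> E v u.
Variable B : nat -> set V.

Fixpoint level (l : nat) : nat -> set V :=
  if l is l'.+1 then fun t => level l' t `\` absorbed E (level l') t else B.

Lemma level_le l m t : (l <= m)%N -> level m t `<=` level l t.
Proof.
by move=> /subnK <-; elim: (m - l)%N => // n IH u [/IH].
Qed.

Lemma not_level l t u : B t u -> ~ level l t u ->
  exists2 l', (l' < l)%N & absorbed E (level l') t u.
Proof.
elim: l => [|l IH] Bu // nl.
have [lu|/(IH Bu) [l' l'l au]] := pselect (level l t u); last by exists l' => //; exact: ltnW.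
by exists l => //; apply: contrapT => nau; apply: nl; split.
Qed.

Hypothesis conv : interval_bags B.

(** Absorption is permanent, so each point loses only a final segment of its life. *)
Lemma level_interval l : interval_bags (level l).
Proof.
elim: l => // l IH u s x s' /andP [sx xs'] [su _] [s'u ns'u].
have xu : level l x u by apply: IH su s'u; rewrite sx.
by split=> // /(absorbed_le xs') /(_ s'u).
Qed.

Lemma level_covers k t l : (l <= k)%N -> covers E k (B t) -> covers E (k - l) (level l t).
Proof.
move=> + cB; elim: l => [|l IH] lk; first by rewrite subn0.
apply: covers_absorbed; first exact: level_interval.
by rewrite subnSK //; apply: IH; apply: ltnW.
Qed.

Lemma absorbed_ex k t u : covers E k (B t) -> B t u ->
  exists2 l, (l < k)%N & absorbed E (level l) t u.
Proof.
move=> cB Bu; apply: not_level => // ku.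
by have := level_covers (leqnn k) cB; rewrite subnn /= => e; rewrite e in ku.
Qed.

(** [e] stands for equality or adjacency in the target graph. Only steps by one unit of time, to the
    same or a lower level, are required, since histories consist of these. *)
Variables (k : nat) (e : nat * nat -> nat * nat -> Prop).
Hypothesis e_step : forall l l' t u, (l' <= l < k)%N ->
  absorbed E (level l) t u -> absorbed E (level l') t.+1 u ->
  (l, stint E (level l) t) = (l', stint E (level l') t.+1) \/
  e (l, stint E (level l) t) (l', stint E (level l') t.+1).

Lemma history_same_level l s t u : (l < k)%N -> (s <= t)%N ->
  absorbed E (level l) s u -> level l t u ->
  reach e 1 (l, stint E (level l) s) (l, stint E (level l) t).
Proof.
move=> lk st asu tu; have cl := @level_interval l.
have [su [s' [a [s's Aa s'a s'u Eau]]]] := asu.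
have st_mono x y := @stint_mono _ E _ cl x y.
have [h|[y [/andP[s'y yt] h1 h2 _ _]]] := stint_change cl Aa s'a s'u Eau (leq_trans s's st) tu.
  have -> : stint E (level l) s = stint E (level l) t; last exact: reach_refl.
  by have := st_mono _ _ s's; have := st_mono _ _ st; lia.
(* If the only change has happened by time [s], nothing changes between [s] and [t]. *)
have [sy|ys] := leqP s y; last first.
  have -> : stint E (level l) s = stint E (level l) t; last exact: reach_refl.
  by have := st_mono _ _ ys; have := st_mono _ _ st; lia.
have -> : stint E (level l) s = stint E (level l) y.
  by have := st_mono _ _ sy; have := st_mono _ _ s's; lia.
have yu : level l y u by apply: cl su tu; rewrite sy ltnW.
have y1u : level l y.+1 u by apply: cl su tu; rewrite leqW.
rewrite -h2; apply: reach1; apply: (@e_step _ _ _ u); first by rewrite leqnn.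
  exact: absorbed_le asu yu.
exact: absorbed_le (leqW sy) asu y1u.
Qed.

(** The bound counts at most one change of anchor on each of the levels [l], ..., 0 and at most [l]
    descents. *)
Lemma history l l' s t u : (l < k)%N -> (s <= t)%N ->
  absorbed E (level l) s u -> absorbed E (level l') t u ->
  reach e (2 * l).+1 (l, stint E (level l) s) (l', stint E (level l') t).
Proof.
elim/ltn_ind: l s => l IH s lk st asu atu.
have [tu|ntu] := pselect (level l t u).
  (* Absorption at a lower level would remove [u] from level [l]; absorption at level [l] removes it
     from all higher ones. *)
  suff ell : l' = l.
    by rewrite ell; apply: reach_le (history_same_level lk st asu tu).
  have ltu' := absorbed_sub atu; case: (ltngtP l' l) => // ll'.
    by have [] := level_le ll' tu.
  by have [_ []] := level_le ll' ltu'; exact: absorbed_le asu tu.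
have Bsu : B s u by apply: (@level_le 0 l) => //; exact: absorbed_sub asu.
have Btu : B t u by apply: (@level_le 0 l') => //; exact: absorbed_sub atu.
(* [x] is the last time of [u] in level [l]; at [x.+1] a lower level [m] has absorbed it. *)
have [x /andP [sx xt] [xu nxu]] : exists2 x, (s <= x < t)%N & level l x u /\ ~ level l x.+1 u.
  apply: contrapT => nex; apply: ntu.
  move: (st) nex => /subnK <-; elim: (t - s)%N => [|m IHm] nex.
    exact: absorbed_sub asu.
  have mu : level l (m + s)%N u.
    apply: IHm => -[x xm h]; apply: nex; exists x => //; lia.
  by apply: contrapT => nmu; apply: nex; exists (m + s)%N => //; lia.
have Bxu : B x.+1 u by apply: conv Bsu Btu; rewrite leqW.
have [m ml amu] := not_level Bxu nxu.
have axu : absorbed E (level l) x u by exact: absorbed_le asu xu.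
have w1 := history_same_level lk sx asu xu.
have w2 : reach e 1 (l, stint E (level l) x) (m, stint E (level m) x.+1).
  by apply: reach1; apply: (@e_step _ _ _ u) => //; rewrite ltnW.
have w3 := IH m ml x.+1 (ltn_trans ml lk) xt amu atu.
apply: reach_le (reach_trans (reach_trans w1 w2) w3); lia.
Qed.

End Levels.

(** At time 0 absorption depends only on the bag there, which both sides share, so the gluing is
    consistent. *)
Lemma absorbed_at0 (V : Type) (E : V -> V -> Prop) (B C : nat -> set V) :
  B 0%N = C 0%N -> absorbed E B 0%N = absorbed E C 0%N.
Proof.
suff abs0 X Y : X 0%N = Y 0%N -> absorbed E X 0%N `<=` absorbed E Y 0%N.
  by move=> BC; rewrite eqEsubset; split; apply: abs0.
move=> XY u [Xu [s [a]]]; rewrite leqn0 => -[/eqP -> Aa Xa _ Ea].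
by split; [rewrite -XY | exists 0%N, a; rewrite /= -XY].
Qed.

Lemma level_at0 (V : Type) (E : V -> V -> Prop) (B C : nat -> set V) l :
  B 0%N = C 0%N -> level E B l 0%N = level E C l 0%N.
Proof.
by move=> BC; elim: l => //= l IH; rewrite IH (absorbed_at0 E IH).
Qed.

(** * The two sides glued at time 0 *)

Section TwoSided.
Variables (V : Type) (E : V -> V -> Prop) (k : nat).
Hypothesis Erefl : forall u, E u u.
Hypothesis Esym : forall u v, E u v -> E v u.
Variable B : int -> set V.

Definition side (e : bool) (t : nat) : int := (if e then t%:Z else - t%:Z)%R.

Definition half (e : bool) (t : nat) : set V := B (side e t).

Definition zlevel (l : nat) (z : int) : nat -> set V := level E (half (0 <= z)%R) l.

Definition zabsorbed (l : nat) (z : int) : set V := absorbed E (zlevel l z) `|z|%N.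

Definition zanchor (l : nat) (z : int) : set V := anchor E (zlevel l z) `|z|%N.

(** The sign keeps the periods of the two sides apart, except that the two periods containing time 0
    merge under the name 0. *)
Definition zstint (l : nat) (z : int) : int :=
  side (0 <= z)%R (stint E (zlevel l z) `|z|%N).

Lemma half_at0 e e' : half e 0%N = half e' 0%N.
Proof. by case: e; case: e'; rewrite /half /side /= ?oppr0. Qed.

Lemma side_abs z : side (0 <= z)%R `|z|%N = z.
Proof. by rewrite /side; case: leP; lia. Qed.

Lemma abs_side e t : `|side e t|%N = t.
Proof. by case: e; rewrite /side; lia. Qed.

Lemma side_ge0 e t : (0 <= side e t)%R = e || (t == 0%N).
Proof. by case: e; rewrite /side; lia. Qed.

Lemma zabsorbed_side l e t : zabsorbed l (side e t) = absorbed E (level E (half e) l) t.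
Proof.
rewrite /zabsorbed /zlevel abs_side side_ge0.
have [->|_] := eqVneq t 0%N; last by rewrite orbF.
apply: absorbed_at0; apply: level_at0; exact: half_at0.
Qed.

Lemma zstint_side l e t : zstint l (side e t) = side e (stint E (level E (half e) l) t).
Proof.
rewrite /zstint /zlevel abs_side side_ge0.
have [->|_] := eqVneq t 0%N; last by rewrite orbF.
by case: e; rewrite /= /side; lia.
Qed.

Lemma zanchor_at0 l e : zanchor l 0 = anchor E (level E (half e) l) 0%N.
Proof. by rewrite /zanchor /zlevel /= (level_at0 E l (half_at0 true e)). Qed.

Hypothesis conv : forall u (s x s' : int), (s <= x <= s')%R -> B s u -> B s' u -> B x u.
Hypothesis cov : forall z, covers E k (B z).

Lemma half_interval e : interval_bags (half e).
Proof.
move=> u s x s' /andP[sx xs'] su s'u; case: e su s'u; rewrite /half /side => su s'u.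
  by apply: conv su s'u; lia.
by apply: conv s'u su; lia.
Qed.

Let zlevel_interval l z : interval_bags (zlevel l z).
Proof. by apply: level_interval; exact: half_interval. Qed.

Lemma zstint_mono l (x y : int) : (x <= y)%R -> (zstint l x <= zstint l y)%R.
Proof.
rewrite /zstint => xy; have mono e s t := @stint_mono _ E _ (@level_interval _ E _ (@half_interval e) l) s t.
rewrite /zlevel /side; have [x0|x0] := leP 0%R x; have [y0|y0] := leP 0%R y; try lia.
  by have := mono true `|x|%N `|y|%N; lia.
by have := mono false `|y|%N `|x|%N; lia.
Qed.

Lemma zstint_anchor l x y : zstint l x = zstint l y -> zanchor l x = zanchor l y.
Proof.
wlog xy : x y / (x <= y)%R.
  by move=> h; case: (leP x y) => [|/ltW] le e; [exact: h|symmetry; exact: h].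
have anc e s t := @stint_anchor _ E _ (@level_interval _ E _ (@half_interval e) l) s t.
rewrite /zstint /zlevel /side /zanchor /zlevel.
have [x0|x0] := leP 0%R x; have [y0|y0] := leP 0%R y; try lia.
- by move=> h; apply: anc; lia.
(* Opposite signs force both periods to begin at time 0, where the sides have the same anchor. *)
- move=> h; rewrite (anc true `|y|%N 0%N); last by rewrite /=; lia.
  rewrite (anc false `|x|%N 0%N) -?zanchor_at0 //; rewrite /=; lia.
- by move=> h; apply: anc; lia.
Qed.

(** A point belongs to every period of the level in which it is alive and already absorbed, so cells
    may overlap. *)
Definition cell (y : nat * int) : set V :=
  [set u | exists2 z, zstint y.1 z = y.2 & zabsorbed y.1 z u].

(** Two steps lead from each point to its anchor, and two more join anchor points through a common
    neighbour. *)
Lemma cell_diameter y u v : cell y u -> cell y v -> reach E 6 u v.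
Proof.
move=> [z ez zu] [z' ez' z'v]; have eA := zstint_anchor (etrans ez (esym ez')).
have [a [Aa [a' uA' A'a]]] := absorbed_near_anchor Erefl Esym (@zlevel_interval y.1 z) zu.
have [b [Ab [b' vB' B'b]]] := absorbed_near_anchor Erefl Esym (@zlevel_interval y.1 z') z'v.
have Ab' : zanchor y.1 z b by rewrite eA.
have [c Eca Ecb] := anchor_near Erefl (@zlevel_interval y.1 z) Aa Ab'.
have st p q : E p q -> reach E 1 p q by move=> ?; apply: reach1; right.
apply: (@reach_trans _ _ 3 3 _ c).
  apply: (reach_trans (st _ _ uA')); apply: (reach_trans (st _ _ A'a)).
  by apply: st; exact: Esym.
apply: (reach_trans (st _ _ Ecb)); apply: (reach_trans (st _ _ (Esym B'b))).
by apply: st; exact: Esym.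
Qed.

Lemma zabsorbed_ex z u : B z u -> exists2 l, (l < k)%N & zabsorbed l z u.
Proof.
move=> Bzu; apply: (@absorbed_ex _ E _ (@half_interval _)); first exact: cov.
by rewrite /half side_abs.
Qed.

Lemma zabsorbed_sub l z : zabsorbed l z `<=` B z.
Proof.
move=> u zu; have := level_le (leq0n l) (absorbed_sub zu).
by rewrite /= /half side_abs.
Qed.

(* Between time [t] and [t + 1] the levels move one at a time, lower levels first
   when this leads away from time 0 and last when it leads towards it. *)
Definition turn (t : int) (l : nat) : nat := if (0 <= t)%R then l else (k - l.+1)%N.

(** Each unit of time is cut into [k.+1] indices [i]. Level [l] shows time [t] up to [turn t l] and
    time [t + 1] from there on; at [turn t l] itself it shows both, so consecutive periods share a
    bag. *)
Definition slot (m : int) (l : nat) (z : int) : Prop :=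
  let t := (m %/ k.+1)%Z in let i := `|(m %% k.+1)%Z|%N in
  (z = t /\ (i <= turn t l)%N) \/ (z = (t + 1)%R /\ (turn t l <= i)%N).

Definition bag (m : int) : set (nat * int) :=
  [set y | (y.1 < k)%N /\ exists2 z, slot m y.1 z & zstint y.1 z = y.2].

Lemma slotE (t : int) (i l : nat) z : (i <= k)%N ->
  slot (t * k.+1%:Z + i%:Z)%R l z <->
  (z = t /\ (i <= turn t l)%N) \/ (z = (t + 1)%R /\ (turn t l <= i)%N).
Proof.
move=> ik; rewrite /slot divzMDl // modzMDl divz_small ?modz_small ?addr0 //; lia.
Qed.

(** The reversed order occurs only when both times are shown at one and the same index. *)
Lemma slot_between (m1 m2 m3 : int) l z1 z3 : (m1 <= m2 <= m3)%R ->
  slot m1 l z1 -> slot m3 l z3 ->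
  exists2 z2, slot m2 l z2 & (z1 <= z2 <= z3)%R || (z3 <= z2 <= z1)%R.
Proof.
have lex (m m' : int) : (m <= m')%R -> ((m %/ k.+1)%Z < (m' %/ k.+1)%Z)%R \/
    (m %/ k.+1)%Z = (m' %/ k.+1)%Z /\ (`|(m %% k.+1)%Z| <= `|(m' %% k.+1)%Z|)%N.
  move=> mm'; have := @lez_pdiv2r k.+1 isT _ _ mm'.
  have := divz_eq m k.+1; have := divz_eq m' k.+1.
  have := modz_ge0 m (d := k.+1) isT; have := modz_ge0 m' (d := k.+1) isT.
  case: (ltgtP (m %/ k.+1)%Z (m' %/ k.+1)%Z) => // [|->]; first by left.
  by right; split=> //; lia.
move=> /andP [/lex h12 /lex h23]; rewrite /slot.
move: h12 h23; set t1 := (m1 %/ _)%Z; set t2 := (m2 %/ _)%Z; set t3 := (m3 %/ _)%Z.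
set i1 := `|_|%N; set i2 := `|_|%N; set i3 := `|_|%N => h12 h23 h1 h3.
have e12 : t1 = t2 -> turn t1 l = turn t2 l by move->.
have e23 : t3 = t2 -> turn t3 l = turn t2 l by move->.
have [lt|lt|eq] := ltngtP i2 (turn t2 l).
- by exists t2; [left; split; lia | lia].
- by exists (t2 + 1)%R; [right; split; lia | lia].
have [z1t|z1t] := leP z1 t2.
  by exists t2; [left; split; lia | lia].
by exists (t2 + 1)%R; [right; split; lia | lia].
Qed.

Lemma bag_interval (m1 m2 m3 : int) :
  (m1 <= m2 <= m3)%R -> bag m1 `&` bag m3 `<=` bag m2.
Proof.
move=> m123 [l n] [[lk [z1 s1 e1]] [_ [z3 s3 e3]]]; split=> //=.
have [z2 s2 /orP[] /andP[h h']] := slot_between m123 s1 s3; exists z2 => //.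
  by have := zstint_mono l h; have := zstint_mono l h'; move: e1 e3 => /=; lia.
by have := zstint_mono l h; have := zstint_mono l h'; move: e1 e3 => /=; lia.
Qed.

Lemma bag_card m : (bag m #<= `I_k.+1)%card.
Proof.
pose t := (m %/ k.+1)%Z; pose i := `|(m %% k.+1)%Z|%N.
pose z l : int := if (i <= turn t l)%N then t else (t + 1)%R.
(* Each vertex goes to its level, except the later one of the level now moving, which takes the
   extra place [k]. *)
pose f (y : nat * int) : nat := if zstint y.1 (z y.1) == y.2 then y.1 else k.
suff /inj_card_eq cardf : set_inj (bag m) f.
  rewrite -(card_le_eql cardf); apply: subset_card_le => _ [[l n] [/= lk _] <-].
  by rewrite /f /=; case: ifP => // _; apply: ltnW.
move=> [l n] [l' n']; rewrite !inE => -[/= lk [x sx ex]] [/= l'k [x' sx' ex']]; rewrite /f /=.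
have late j p q : slot m j p -> zstint j p = q -> (zstint j (z j) == q) = false -> turn t j = i.
  rewrite /slot -/t -/i /z => -[[-> h]|[-> h]] <-; first by rewrite h eqxx.
  by case: leqP => h'; [lia | rewrite eqxx].
have [<-|] := eqP; have [<-|] := eqP; try lia.
  by move=> ->.
move=> /eqP /negPf h' /eqP /negPf h _.
have := late _ _ _ sx ex h; have := late _ _ _ sx' ex' h'.
(* Distinct levels move at distinct indices, so only one vertex can go to [k]. *)
move=> e1 e2; have ell : l = l' by move: e1 e2; rewrite /turn; case: ifP; lia.
congr (_, _) => //; rewrite -ex -ex' -ell; congr zstint.
move: sx sx' h h'; rewrite /slot -/t -/i -ell -ex -ex' -ell /z.
by case: leqP => [it|it]; case=> [[-> _]|[-> h1]]; case=> [[-> _]|[-> h2]]; rewrite ?eqxx //; lia.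
Qed.

(** * Adjacency in the target graph and bounded histories *)

Variable adjV : V -> V -> Prop.

(** The common bag makes the bags a path-decomposition; the pair [u], [w] lets walks be lifted back
    to the original graph. *)
Definition nerve_adj (y y' : nat * int) : Prop :=
  [/\ y <> y', exists2 m, bag m y & bag m y'
    & exists u w, [/\ cell y u, cell y' w & u = w \/ adjV u w]].

Lemma nerve_adj_sym y y' : (forall u v, adjV u v -> adjV v u) ->
  nerve_adj y y' -> nerve_adj y' y.
Proof.
move=> sym [ne [m my my'] [u [w [yu yw uw]]]]; split; first exact: nesym.
  by exists m.
by exists w, u; split=> //; case: uw => [->|/sym]; [left|right].
Qed.

Definition spot (l : nat) (z : int) : nat * int := (l, zstint l z).

Lemma same_time l l' z u w : (l < k)%N -> (l' < k)%N ->
  zabsorbed l z u -> zabsorbed l' z w -> u = w \/ adjV u w ->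
  reach nerve_adj 1 (spot l z) (spot l' z).
Proof.
move=> lk l'k zu zw uw; apply: reach1.
have [->|ne] := eqVneq (spot l z) (spot l' z); [by left | right].
split; first exact/eqP.
  exists (z * k.+1%:Z + 0%:Z)%R; split=> //=; exists z => //; apply/slotE => //; left; split=> //.
by exists u, w; split=> //; exists z.
Qed.

(** At the index where level [l] moves it shows both times. The lower level [l'] shows the outer
    time there, having already moved outwards or, on the negative side, not yet inwards. *)
Lemma outward_step e t l l' u : (l' <= l < k)%N ->
  zabsorbed l (side e t) u -> zabsorbed l' (side e t.+1) u ->
  spot l (side e t) = spot l' (side e t.+1) \/
  nerve_adj (spot l (side e t)) (spot l' (side e t.+1)).
Proof.
move=> /andP [l'l lk] tu t1u.
have [->|ne] := eqVneq (spot l (side e t)) (spot l' (side e t.+1)); [by left | right].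
split; first exact/eqP.
  case: e {tu t1u ne}; rewrite /side.
    have tE j : turn t j = j by [].
    exists (t%:Z * k.+1%:Z + l%:Z)%R; (split=> /=; first lia).
      by exists (t%:Z)%R => //; apply/slotE; rewrite ?tE; lia.
    by exists (t.+1%:Z)%R => //; apply/slotE; rewrite ?tE; lia.
  have tE j : turn (- t.+1%:Z)%R j = (k - j.+1)%N by rewrite /turn; case: leP; lia.
  exists (- t.+1%:Z * k.+1%:Z + (k - l.+1)%N%:Z)%R; (split=> /=; first lia).
    by exists (- t%:Z)%R => //; apply/slotE; rewrite ?tE; lia.
  by exists (- t.+1%:Z)%R => //; apply/slotE; rewrite ?tE; lia.
by exists u, u; split; [exists (side e t) | exists (side e t.+1) | left].
Qed.

Hypothesis adjV_sym : forall u v, adjV u v -> adjV v u.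

Lemma history_side e s t l l' u : (l < k)%N -> (l' < k)%N ->
  zabsorbed l (side e s) u -> zabsorbed l' (side e t) u ->
  reach nerve_adj (2 * k) (spot l (side e s)) (spot l' (side e t)).
Proof.
wlog st : l l' s t / (s <= t)%N.
  move=> h lk l'k su tu; case: (leqP s t) => [|/ltnW] le; first exact: h.
  by apply: reach_sym (h _ _ _ _ le l'k lk tu su) => y y'; exact: nerve_adj_sym.
move=> lk _ su tu; apply: (@reach_le _ _ (2 * l).+1); first by lia.
pose f (y : nat * nat) := (y.1, side e y.2).
have spotE j x : spot j (side e x) = f (j, stint E (level E (half e) j) x).
  by rewrite /spot zstint_side.
rewrite !spotE.
apply: (@reach_map _ _ (fun y y' => f y = f y' \/ nerve_adj (f y) (f y'))) => //.
move: su tu; rewrite !zabsorbed_side => su tu.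
apply: (history (@half_interval e) _ lk st su tu) => j j' x v jj xv x1v.
by right; rewrite -!spotE; apply: (@outward_step _ _ _ _ v) => //; rewrite zabsorbed_side.
Qed.

Lemma history_all l l' z z' u : (l < k)%N -> (l' < k)%N ->
  zabsorbed l z u -> zabsorbed l' z' u ->
  reach nerve_adj (4 * k) (spot l z) (spot l' z').
Proof.
wlog zz : l l' z z' / (z <= z')%R.
  move=> h lk l'k su tu; case: (leP z z') => [|/ltW] le; first exact: h.
  by apply: reach_sym (h _ _ _ _ le l'k lk tu su) => y y'; exact: nerve_adj_sym.
move=> lk l'k zu z'u.
have ss e x y : z = side e x -> z' = side e y -> reach nerve_adj (2 * k) (spot l z) (spot l' z').
  by move=> ez ez'; rewrite ez ez'; apply: (@history_side _ _ _ _ _ u) => //; rewrite -?ez -?ez'.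
have [z0|z0] := leP 0%R z.
  apply: reach_le (ss true `|z|%N `|z'|%N _ _); rewrite /side; lia.
have [z'0|z'0] := leP z' 0%R.
  apply: reach_le (ss false `|z|%N `|z'|%N _ _); rewrite /side; lia.
(* The times lie on opposite sides, so [u] is alive at 0, and a level [j] absorbing it there joins
   the two one-sided histories. *)
have B0 : B 0%R u by apply: conv (zabsorbed_sub zu) (zabsorbed_sub z'u); lia.
have [j jk ju] := zabsorbed_ex B0.
have -> : (4 * k = 2 * k + 2 * k)%N by lia.
have ez : z = side false `|z|%N by rewrite /side; lia.
have ez' : z' = side true `|z'|%N by rewrite /side; lia.
apply: (@reach_trans _ _ _ _ _ (spot j 0)).
  have := @history_side false `|z|%N 0%N l j u lk jk; rewrite -ez /side oppr0; exact.
by have := @history_side true 0%N `|z'|%N j l' u jk l'k; rewrite -ez' /side; exact.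
Qed.

Lemma cell_history y y' u : (y.1 < k)%N -> (y'.1 < k)%N -> cell y u -> cell y' u ->
  reach nerve_adj (4 * k) y y'.
Proof.
by case: y y' => l n [l' n'] /= lk l'k [z /= <- zu] [z' /= <- z'u]; exact: (history_all lk l'k zu z'u).
Qed.

(** Follow the history of [u] to time [z], pass to a level of [v] at that time, and follow the
    history of [v]. *)
Lemma cell_adj y y' u v z : (y.1 < k)%N -> (y'.1 < k)%N -> cell y u -> cell y' v ->
  B z u -> B z v -> adjV u v -> reach nerve_adj (8 * k + 1) y y'.
Proof.
move=> yk y'k yu y'v zu zv uv.
have [l lk lu] := zabsorbed_ex zu; have [l' l'k l'v] := zabsorbed_ex zv.
have -> : (8 * k + 1 = 4 * k + 1 + 4 * k)%N by lia.
apply: (@reach_trans _ _ _ _ _ (spot l' z)); last first.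
  by apply: (cell_history _ _ _ y'v) => //; exists z.
apply: (@reach_trans _ _ _ _ _ (spot l z)).
  by apply: (cell_history _ _ yu) => //; exists z.
by apply: same_time lu l'v _ => //; right.
Qed.

End TwoSided.

Local Open Scope ring_scope.

(** * Distances and path-decompositions *)

Lemma reach_mul T (e : T -> T -> Prop) m n x y :
  reach (reach e m) n x y -> reach e (n * m)%N x y.
Proof.
elim: n x => [|n IH] x //= [z xz /IH zy]; rewrite mulSn; apply: reach_trans zy.
by case: xz => [->|//]; exact: reach_refl.
Qed.

Lemma path_between_reach (G : graph) (u v : G) p n :
  path_between u v p n -> reach (@adj G) n u v.
Proof.
move=> [[_ step] <- <-]; elim: n step => // n IH step.
apply: (@reach_le _ _ (n + 1)%N); first by rewrite addn1.
apply: reach_trans (IH (fun i ilt => step i (ltnW ilt))) _.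
by apply: reach1; right; apply: step.
Qed.

Lemma reach_path (G : graph) (u v : G) n :
  reach (@adj G) n u v -> exists m p, (m <= n)%N /\ path_between u v p m.
Proof.
pose W m := exists p : nat -> G, [/\ p 0%N = u, p m = v & forall i, (i < m)%N -> adj (p i) (p i.+1)].
move=> uv; have [m mn Wm] : exists2 m, (m <= n)%N & W m.
  rewrite /W {W}; elim: n u uv => [|n IH] u /=; first by move=> ->; exists 0%N => //; exists (fun=> v).
  move=> [z uz /IH [m mn [p [p0 pm step]]]]; case: uz => [->|uz].
    by exists m; [exact: leqW|exists p].
  exists m.+1 => //; exists (fun i => if i is i'.+1 then p i' else u); split=> //.
  by case=> [_|i im]; [rewrite p0 | exact: step].
have exW : exists m, `[< W m >] by exists m; apply/asboolP.
case: (ex_minnP exW) => {}m' /asboolP [p [p0 pm step]] least.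
have m'n : (m' <= n)%N by apply: leq_trans (least m _) mn; apply/asboolP.
exists m', p; split=> //; split=> //; split=> // i j.
wlog ij : i j / (i < j)%N.
  move=> h im jm pij; case: (ltngtP i j) => // ij; first exact: h.
  by apply/esym; apply: h.
(* Cutting out the part between the equal points [p i] and [p j] gives a shorter walk. *)
move=> _ jm pij; suff /asboolP /least : W (m' - (j - i))%N by lia.
exists (fun x => if (x <= i)%N then p x else p (x + (j - i))%N); split=> [||x xm].
- by rewrite /= p0.
- case: leqP => h; last by rewrite subnK //; lia.
  have e : (m' - (j - i) = i)%N by lia.
  by rewrite e pij -pm; congr p; lia.
- case: (ltngtP x i) => xi; last first.
  + by rewrite xi pij; have := step j; rewrite addSn subnKC ?(ltnW ij) //; apply; lia.
  + by rewrite addSn; apply: step; lia.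
  + by apply: step; lia.
Qed.

Lemma reach_dist (R : realType) (G : graph) (u v : G) n :
  reach (@adj G) n u v -> (dist R u v <= n%:R%:E)%E.
Proof.
move=> /reach_path [m [p [mn pb]]]; apply: (@le_trans _ _ m%:R%:E).
  by apply: ereal_inf_lbound; exists m => //; exists p.
by rewrite lee_fin ler_nat.
Qed.

Lemma dist_reach (R : realType) (G : graph) (u v : G) :
  (dist R u v < +oo)%E -> exists2 n, dist R u v = n%:R%:E & reach (@adj G) n u v.
Proof.
move=> /ereal_inf_ltP [_ [n0 [p0 pb0] _] _].
have exP : exists n, `[< exists p, path_between u v p n >] by exists n0; apply/asboolP; exists p0.
case: (ex_minnP exP) => n /asboolP [p pb] least; exists n; last exact: path_between_reach pb.
apply/le_anti/andP; split; first by apply: ereal_inf_lbound; exists n => //; exists p.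
apply/ereal_infP => _ [m [q qb] <-]; rewrite lee_fin ler_nat; apply: least.
by apply/asboolP; exists q.
Qed.

Lemma quasi_isometry_of_reach (R : realType) (G H : graph) (phi : G -> H) (c : nat) :
  (forall n u v, reach (@adj G) n u v -> reach (@adj H) (c * n + c) (phi u) (phi v)) ->
  (forall n u v, reach (@adj H) n (phi u) (phi v) -> reach (@adj G) (c * n + c) u v) ->
  (forall y, exists v, reach (@adj H) c (phi v) y) ->
  quasi_isometry (c%:R : R) c%:R phi.
Proof.
move=> h1 h2 h3; split=> [u v /dist_reach [n -> /h1 h]|u v /dist_reach [n -> /h2 h]|y].
- by have := reach_dist R h; rewrite natrD natrM.
- by have := reach_dist R h; rewrite natrD natrM.
- by have [v h] := h3 y; exists v; exact: reach_dist.
Qed.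

Definition zadj (i j : int) : Prop := i = j + 1 \/ j = i + 1.

Lemma zadj_sym i j : zadj i j -> zadj j i.
Proof. by case; [right | left]. Qed.

Lemma zadj_irrefl i : ~ zadj i i.
Proof. by case; lia. Qed.

Definition zpath : graph := Graph zadj_sym zadj_irrefl.

(** Injectivity forbids turning back, so the first step fixes the direction. *)
Lemma zpath_monotone (p : nat -> zpath) n : path_of_length p n ->
  (forall i, (i <= n)%N -> p i = p 0%N + i%:Z :> int) \/
  (forall i, (i <= n)%N -> p i = p 0%N - i%:Z :> int).
Proof.
elim: n => [|n IH] [inj step].
  by left=> i; rewrite leqn0 => /eqP ->; rewrite addr0.
have := IH (conj (fun i j im jm => inj i j (leqW im) (leqW jm)) (fun i im => step i (leqW im))).
have := step n (leqnn _); case: n {IH} inj step => [|n] inj step stp.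
  move=> _; case: stp => stp; [right|left] => -[_|[_|//]]; rewrite ?subr0 ?addr0 //; rewrite stp; lia.
have ne : p n.+2 <> p n by move=> /inj; lia.
case=> h; [left|right] => i; rewrite leq_eqVlt => /orP[/eqP ->|/h //].
  by have := h n.+1 (leqnn _); have := h n (leqnSn _); case: stp => stp e1 e2; [case: ne|]; lia.
by have := h n.+1 (leqnn _); have := h n (leqnSn _); case: stp => stp e1 e2; [|case: ne]; lia.
Qed.

Lemma zpath_tree : is_tree zpath.
Proof.
split; first exact: (inhabits (0 : int)).
  move=> u v; have [uv|vu] := leP (u : int) (v : int).
    exists (fun i => (u : int) + i%:Z), `|(v : int) - u|%N; split; [|lia|lia].
    by split=> [i j|i] *; [lia | right; lia].
  exists (fun i => (u : int) - i%:Z), `|(v : int) - u|%N; split; [|lia|lia].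
  by split=> [i j|i] *; [lia | left; lia].
move=> p n n2 /zpath_monotone [] h /=; have := h n (leqnn n); rewrite /zadj /=; lia.
Qed.

Lemma zpath_is_path : is_path_graph zpath.
Proof.
exists setT, (fun i : zpath => i : int); split=> //; first exact: Or33.
  by rewrite eqEsubset; split=> // i _; exists i.
by move=> s t; split=> -[]; by [left | right].
Qed.

Lemma zpath_between (t1 t2 t3 : zpath) : on_path_between t1 t2 t3 ->
  ((t1 : int) <= t2 <= t3) || ((t3 : int) <= t2 <= t1).
Proof.
move=> [p [n [[/zpath_monotone h <- <-] [i im <-]]]].
by case: h => h; have := h i im; have := h n (leqnn n); lia.
Qed.

Lemma path_decomposition_int (G T : graph) (B : T -> set G) : path_decomposition B ->
  exists f : T -> int, let C z := [set v | exists2 t, f t = z & B t v] in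
  [/\ injective f, forall v, exists z, C z v,
      forall u v, adj u v -> exists z, C z u /\ C z v
    & forall v (s x s' : int), s <= x <= s' -> C s v -> C s' v -> C x v].
Proof.
move=> [[D [f [Dspec finj fD fadj]]] [_ [cov edge conv]]]; exists f; split=> //.
- by move=> v; have [t Btv] := cov v; exists (f t); exists t.
- move=> u v /edge [t [Btu Btv]]; exists (f t); split; by exists t.
move=> v s x s' sxs' [t1 ft1 B1] [t3 ft3 B3].
have Dconv z : s <= z <= s' -> exists t, f t = z.
  move=> szs'; suff : D z by rewrite -fD => -[t _ <-]; exists t.
  have [Ds Ds'] : D s /\ D s' by rewrite -fD; split; [exists t1 | exists t3].
  by case: Dspec Ds Ds' => [[n ->]|->|->] //=; lia.
(* [g] inverts [f]; the default [t1] never occurs between [s] and [s'], where [g] traces the path of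
   [T] from [t1] to [t3]. *)
pose g z := if pselect (exists t, f t = z) is left e then projT1 (cid e) else t1.
have gE z : s <= z <= s' -> f (g z) = z.
  by move=> /Dconv e; rewrite /g; case: pselect => // e'; exact: projT2 (cid e').
exists (g x); first by apply: gE.
apply: (conv t1 _ t3); last by split.
exists (fun i => g (s + i%:Z)), `|s' - s|%N; split; last first.
  by exists `|x - s|%N; [lia | congr g; lia].
split; [split=> [i j il jl /(congr1 f)|i il]| |].
- by rewrite !gE; lia.
- by apply/fadj; rewrite !gE; lia.
- by apply: finj; rewrite gE; lia.
- by apply: finj; rewrite gE; lia.
Qed.

Lemma ecard_le (R : realType) (V : Type) (A : set V) n :
  (A #<= `I_n)%card -> (ecard R A <= n%:R%:E)%E.
Proof.
move=> An; have /finite_setP [m Am] : finite_set A by apply/finite_set_leP; exists n.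
apply: (@le_trans _ _ m%:R%:E); first by apply: ereal_inf_lbound; exists m.
by rewrite lee_fin ler_nat -card_le_II -(card_le_eql Am).
Qed.

(** Distances are integers, so [r] may be replaced by a natural number above it. *)
Lemma diameter_reach (R : realType) (r : R) (G : graph) (F : set G) u v :
  (diameter R F <= r%:E)%E -> F u -> F v -> reach (@adj G) (Num.trunc r).+1 u v.
Proof.
move=> Fr Fu Fv; have uvr : (dist R u v <= r%:E)%E.
  by apply: le_trans Fr; apply: ereal_sup_ubound; exists u, v.
have [n e uv] := dist_reach (le_lt_trans uvr (ltry r)).
apply: reach_le uv; rewrite e lee_fin in uvr.
by apply: ltnW; rewrite -(ltr_nat R); exact: le_lt_trans uvr (truncnS_gt r).
Qed.

(** * The target graph *)

Section Nerve.
Variables (G : graph) (B : int -> set G) (k N : nat).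
Hypothesis conv : forall u (s x s' : int), s <= x <= s' -> B s u -> B s' u -> B x u.
Hypothesis vertices : forall u, exists z, B z u.
Hypothesis edges : forall u v, adj u v -> exists z, B z u /\ B z v.

Let E : G -> G -> Prop := reach (@adj G) N.

Hypothesis cov : forall z, covers E k (B z).

Let Erefl u : E u u. Proof. exact: reach_refl. Qed.
Let Esym u v : E u v -> E v u. Proof. by apply: reach_sym; exact: adj_sym. Qed.

Let raw := nerve_adj E k B (@adj G).

(** Empty cells are excluded so that every vertex is near the image of [nerve_map]. *)
Definition nerve_vertex := {y : nat * int | (y.1 < k)%N /\ cell E B y !=set0}.

Definition nerve_edge (y y' : nerve_vertex) : Prop := raw (sval y) (sval y').

Lemma nerve_edge_sym y y' : nerve_edge y y' -> nerve_edge y' y.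
Proof. by apply: nerve_adj_sym; exact: adj_sym. Qed.

Lemma nerve_edge_irrefl y : ~ nerve_edge y y.
Proof. by case. Qed.

Definition nerve : graph := Graph nerve_edge_sym nerve_edge_irrefl.

Definition nerve_bag (m : zpath) : set nerve := [set y | bag E k B m (sval y)].

Lemma nerve_path_decomposition : path_decomposition nerve_bag.
Proof.
split; first exact: zpath_is_path.
split; first exact: zpath_tree.
split=> [[y [yk [u [z zy zu]]]]|y y' [_ [m my my'] _]|t1 t2 t3 /zpath_between t123 y [y1 y3]].
- exists (z * k.+1%:Z + 0%:Z); split=> //=; exists z => //.
  by apply/slotE => //; left.
- by exists m.
- by case/orP: t123 => t123; apply: (bag_interval conv t123); split.
Qed.

Lemma nerve_pathwidth (R : realType) : (pathwidth R nerve <= k%:R%:E)%E.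
Proof.
apply: (@le_trans _ _ (width R nerve_bag)).
  by apply: ereal_inf_lbound; exists zpath, nerve_bag; split=> //; exact: nerve_path_decomposition.
apply: ge_ereal_sup => _ [m _ <-].
have sub : (nerve_bag m #<= `I_k.+1)%card.
  apply: card_le_trans (bag_card E k B m).
  have /inj_card_eq e : set_inj (nerve_bag m) (@sval _ _ : nerve -> nat * int).
    by move=> [y hy] [y' hy'] _ _ /=; exact: eq_exist.
  by rewrite -(card_le_eql e); apply: subset_card_le => _ [y my <-].
by rewrite leeBlDr // -EFinD natr1; exact: ecard_le.
Qed.

(** Vertices inside the walk are ends of edges, so they have level below [k] and a non-empty
    cell. *)
Lemma reach_nerve n (y y' : nerve) : reach raw n (sval y) (sval y') -> reach (@adj nerve) n y y'.
Proof.
elim: n y => [|n IH] y /=.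
  by case: y y' => y hy [y' hy'] /=; exact: eq_exist.
move=> [z [<-|yz] zy']; first by exists y; [left | exact: IH].
have hz : (z.1 < k)%N /\ cell E B z !=set0.
  by case: yz => _ [m _ [zk _]] [u [w [_ zw _]]]; split=> //; exists w.
by exists (exist _ z hz); [right | exact: IH].
Qed.

Lemma nerve_map_ex u : exists y : nerve, cell E B (sval y) u.
Proof.
have [z Bzu] := vertices u; have [l lk lu] := zabsorbed_ex conv cov Bzu.
have lzu : cell E B (spot E B l z) u by exists z.
by exists (exist _ (spot E B l z) (conj lk (ex_intro _ u lzu))).
Qed.

(** Which cell containing [u] is chosen does not matter: by [cell_history] they are within [4 * k]
    of each other. *)
Definition nerve_map (u : G) : nerve := projT1 (cid (nerve_map_ex u)).

Lemma nerve_mapP u : cell E B (sval (nerve_map u)) u.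
Proof. exact: projT2 (cid (nerve_map_ex u)). Qed.

Lemma nerve_map_reach n u v : reach (@adj G) n u v ->
  reach (@adj nerve) (n * (8 * k + 1))%N (nerve_map u) (nerve_map v).
Proof.
move=> uv; apply: reach_mul; apply: reach_map uv => {}u {}v uv; right.
have [z [zu zv]] := edges uv; apply: reach_nerve.
apply: (cell_adj conv cov (@adj_sym G) _ _ (nerve_mapP u) (nerve_mapP v) zu zv uv).
  exact: (proj1 (svalP (nerve_map u))).
exact: (proj1 (svalP (nerve_map v))).
Qed.

(** Each of the [n + 1] cells on the walk costs at most [6 * N] edges of [G] to cross, and each of
    the [n] edges at most one more. *)
Lemma cell_reach n (y y' : nerve) u v : cell E B (sval y) u -> cell E B (sval y') v ->
  reach (@adj nerve) n y y' -> reach (@adj G) (n * (6 * N + 1) + 6 * N)%N u v.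
Proof.
have diam (z : nerve) p q : cell E B (sval z) p -> cell E B (sval z) q -> reach (@adj G) (6 * N) p q.
  by move=> zp zq; apply: reach_mul; exact: (cell_diameter Erefl Esym conv zp zq).
move=> + y'v; elim: n y u => [|n IH] y u yu /=.
  by move=> e; apply: (diam y) => //; rewrite e.
move=> [z [<-|[_ _ [p [q [yp zq pq]]]]] zy'].
  by apply: reach_le (IH y u yu zy'); lia.
apply: (@reach_le _ _ (6 * N + (1 + (n * (6 * N + 1) + 6 * N)))%N); first by lia.
apply: reach_trans (diam y _ _ yu yp) _; apply: reach_trans (reach1 pq) _.
exact: IH zq zy'.
Qed.

Lemma nerve_map_quasi_isometry (R : realType) (c : nat) : c = (8 * k + 6 * N + 1)%N ->
  quasi_isometry (c%:R : R) c%:R nerve_map.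
Proof.
(* The constant dominates [8 * k + 1], [6 * N + 1] and [4 * k], one for each clause. *)
move=> ->; apply: quasi_isometry_of_reach => [n u v uv|n u v uv|y].
- by apply: reach_le (nerve_map_reach uv); nia.
- by apply: reach_le (cell_reach (nerve_mapP u) (nerve_mapP v) uv); nia.
have [yk [u yu]] := svalP y; exists u; apply: reach_nerve.
apply: (@reach_le _ _ (4 * k)); first by lia.
apply: (cell_history conv cov (@adj_sym G) _ yk (nerve_mapP u) yu).
exact: (proj1 (svalP (nerve_map u))).
Qed.

End Nerve.

Theorem mainTheorem2 (R : realType) (k : nat) (r : R) (hr : 0 <= r) :
  exists L C : R, 1 <= L /\ 1 <= C /\
    forall G : graph,
      (exists (T : graph) (B : T -> set G),
        path_decomposition B /\
        forall t : T, exists (m : nat) (F : 'I_m -> set G),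
          [/\ (m <= k)%N, B t = \bigcup_i F i
            & forall i, (diameter R (F i) <= r%:E)%E]) ->
      exists H : graph,
        (pathwidth R H <= k%:R%:E)%E /\ admits_quasi_isometry L C G H.
Proof.
pose N := (Num.trunc r).+1; pose c := (8 * k + 6 * N + 1)%N.
have c1 : 1 <= c%:R :> R by rewrite -[1]/(1%:R) ler_nat /c addn1.
exists c%:R, c%:R; do 2!split=> //; move=> G [T [B [dec small]]].
have [f [finj vertices edges conv]] := path_decomposition_int dec.
pose C z := [set v | exists2 t, f t = z & B t v].
have cov z : covers (reach (@adj G) N) k (C z).
  (* An integer that is no position on the path has an empty bag. *)
  have [[t ftz]|nt] := pselect (exists t, f t = z); last first.
    apply: (@covers_le _ _ 0) => //=; rewrite -subset0 => v [t ftz _].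
    by apply: nt; exists t.
  have [m [F [mk BtF Fsmall]]] := small t.
  apply: covers_le mk _; apply: (@covers_bigcup _ _ _ F) => [i u v|v [t' ft' Bv]].
    exact: diameter_reach.
  by rewrite -BtF; rewrite -ftz in ft'; rewrite -(finj _ _ ft').
exists (nerve C k N); split; first exact: nerve_pathwidth.
exists (nerve_map conv vertices cov).
exact: (nerve_map_quasi_isometry conv vertices edges cov).
Qed.
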